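(* An epimorphism $\pi\colon H\twoheadrightarrow G$ of profinite groups is fundamental if and only if it is isomorphic (over $G$) to the structure map of the fiber product over $G$ of a (possibly empty or infinite) family of indecomposable epimorphisms onto $G$.
   Context: All groups are profinite, homomorphisms are continuous, subgroups are closed. Epimorphisms $\eta\colon H\twoheadrightarrow G$ and $\pi\colon E\twoheadrightarrow G$ are isomorphic if there is an isomorphism $\psi\colon H\to E$ with $\eta=\pi\circ\psi$. An epimorphism is indecomposable if it is not an isomorphism and cannot be written as a composition of two epimorphisms neither of which is an isomorphism. For $M\triangleleft H$, $\mathcal{N}_M(H)$ is the set of maximal elements among the normal subgroups of $H$ strictly contained in $M$. The fundament kernel of $\pi$ is $\mathcal{M}(\pi)=\bigcap_{N\in\mathcal{N}_{\operatorname{Ker}\pi}(H)}N$ (equal to $\operatorname{Ker}\pi$ if $\operatorname{Ker}\pi=1$, when the family is empty); $\pi$ is fundamental if $\mathcal{M}(\pi)=1$. The fiber product of a family $(\eta_i\colon H_i\twoheadrightarrow G)_{i\in I}$ is $\{(h_i)\in\prod_{i\in I}H_i : \eta_i(h_i)=\eta_j(h_j)\ \forall i,j\in I\}$ with structure map $(h_i)_i\mapsto\eta_j(h_j)$ (independent of $j$); for $I=\emptyset$ it is $G$ with structure map $\mathrm{id}_G$. *)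

(* Defs.v *)
From HB Require Import structures.
From mathcomp Require Import all_boot.
From mathcomp Require Import all_classical topology.

Set Implicit Arguments.
Unset Strict Implicit.
Unset Printing Implicit Defensive.

Local Open Scope classical_set_scope.
Local Open Scope group_scope.

HB.structure Definition PreTopologicalGroup :=
  {G of Topological G & Group G}.

HB.mixin Record PreTopologicalGroup_isTopologicalGroup G
    of PreTopologicalGroup G := {
  mulg_continuous : continuous (fun x : G * G => x.1 * x.2);
  invg_continuous : continuous (fun x : G => x^-1)
}.

#[short(type="topologicalGroupType")]
HB.structure Definition TopologicalGroup :=
  {G of PreTopologicalGroup G & PreTopologicalGroup_isTopologicalGroup G}.

HB.mixin Record TopologicalGroup_isProfinite G of TopologicalGroup G := {
  profinite_compact : compact [set: G];
  profinite_hausdorff : hausdorff_space G;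
  profinite_totally_disconnected : totally_disconnected [set: G]
}.

#[short(type="profiniteGroupType")]
HB.structure Definition ProfiniteGroup :=
  {G of TopologicalGroup G & TopologicalGroup_isProfinite G}.

Record epimorphism (H G : profiniteGroupType) := Epimorphism {
  epi_fun :> H -> G;
  epiM : {morph epi_fun : x y / x * y};
  epi_continuous : continuous epi_fun;
  epi_surj : forall y, exists x, epi_fun x = y
}.

Definition isomorphism (H E : profiniteGroupType) (f : H -> E) : Prop :=
  [/\ {morph f : x y / x * y}, continuous f &
      exists g : E -> H, [/\ cancel f g, cancel g f & continuous g]].

Definition isomorphic_over (G H E : profiniteGroupType)
    (eta : epimorphism H G) (pi : epimorphism E G) : Prop :=
  exists2 psi : H -> E, isomorphism psi & eta =1 pi \o psi.

Definition indecomposable (H G : profiniteGroupType) (eta : epimorphism H G)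
    : Prop :=
  ~ isomorphism eta /\
  ~ exists (K : profiniteGroupType) (f : epimorphism H K)
      (g : epimorphism K G),
      [/\ eta =1 g \o f, ~ isomorphism f & ~ isomorphism g].

(* Subgroups of profinite groups are closed by convention. *)
Definition normal_subgroup (H : profiniteGroupType) (N : set H) : Prop :=
  [/\ N 1, (forall x y, N x -> N y -> N (x * y)),
      (forall x, N x -> N x^-1), (forall x y, N x -> N (x ^ y)) & closed N].

Definition max_normal_in (H : profiniteGroupType) (M : set H)
    : set (set H) :=
  [set N | [/\ normal_subgroup N, N `<` M &
     forall N', normal_subgroup N' -> N' `<` M -> N `<=` N' -> N' = N]].

Section Fundament.
Variables (H G : profiniteGroupType) (pi : epimorphism H G).

Definition kernel : set H := [set x | pi x = 1].

(* The intersection is taken inside the kernel, which contains all members of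
   the family; hence it is the kernel when the family is empty. *)
Definition fundament_kernel : set H :=
  kernel `&` \bigcap_(N in max_normal_in kernel) N.

Definition fundamental : Prop := fundament_kernel = [set 1].

End Fundament.

Section EpiTheory.
Variables (H G : profiniteGroupType) (f : epimorphism H G).

Lemma epi1 : f 1 = 1.
Proof. by apply: (mulgI (f 1)); rewrite -epiM !mulg1. Qed.

Lemma epiV : {morph f : x / x^-1}.
Proof. by move=> x; apply: (mulgI (f x)); rewrite -epiM !mulgV epi1. Qed.

End EpiTheory.

Lemma closed_equalizer (X Y : topologicalType) (f g : X -> Y) :
  hausdorff_space Y -> continuous f -> continuous g ->
  closed [set x | f x = g x].
Proof.
move=> hY cf cg x clx; apply: hY => A B nA nB.
have nAB : nbhs x (f @^-1` A `&` g @^-1` B).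
  by apply: filterI; [exact: cf|exact: cg].
have [y [/= fg [fA gB]]] := clx _ nAB.
by exists (f y); split => //; rewrite fg.
Qed.

Section FiberSubgroup.
Variables (I : Type) (G : profiniteGroupType) (E : I -> profiniteGroupType).
Variable eta : forall i, epimorphism (E i) G.

Definition fiber_set : set (prod_topology E) :=
  [set h | forall i j, eta i (h i) = eta j (h j)].

(* The set of compatible families, with the subspace topology of the product.
   For an empty I this is the trivial group; see [fiber_product]. *)
Definition fiber_subgroup : Type := set_type fiber_set.

HB.instance Definition _ := Topological.on fiber_subgroup.

Definition fiber_coord (i : I) (x : fiber_subgroup) : E i := val x i.

Lemma fiber_coordP (x : fiber_subgroup) i j :
  eta i (fiber_coord i x) = eta j (fiber_coord j x).
Proof. exact: (set_mem (valP x)). Qed.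

Definition fiber_build (h : forall i, E i)
  (hh : forall i j, eta i (h i) = eta j (h j)) : fiber_subgroup :=
  exist _ (h : prod_topology E) (mem_set hh).

Lemma fiber_ext (x y : fiber_subgroup) :
  (forall i, fiber_coord i x = fiber_coord i y) -> x = y.
Proof. by move=> xy; apply: val_inj; apply: functional_extensionality_dep. Qed.

Definition fiber_one : fiber_subgroup.
Proof. by apply: (@fiber_build (fun=> 1)) => i j; rewrite !epi1. Defined.

Definition fiber_inv (x : fiber_subgroup) : fiber_subgroup.
Proof.
apply: (@fiber_build (fun i => (fiber_coord i x)^-1)) => i j.
by rewrite !epiV (fiber_coordP x i j).
Defined.

Definition fiber_mul (x y : fiber_subgroup) : fiber_subgroup.
Proof.
apply: (@fiber_build (fun i => fiber_coord i x * fiber_coord i y)) => i j.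
by rewrite !epiM (fiber_coordP x i j) (fiber_coordP y i j).
Defined.

Lemma fiber_mulA : associative fiber_mul.
Proof. by move=> x y z; apply: fiber_ext => i; exact: mulgA. Qed.
Lemma fiber_mul1 : left_id fiber_one fiber_mul.
Proof. by move=> x; apply: fiber_ext => i; exact: mul1g. Qed.
Lemma fiber_mulr1 : right_id fiber_one fiber_mul.
Proof. by move=> x; apply: fiber_ext => i; exact: mulg1. Qed.
Lemma fiber_mulV : left_inverse fiber_one fiber_inv fiber_mul.
Proof. by move=> x; apply: fiber_ext => i; exact: mulVg. Qed.
Lemma fiber_mulrV : right_inverse fiber_one fiber_inv fiber_mul.
Proof. by move=> x; apply: fiber_ext => i; exact: mulgV. Qed.

HB.instance Definition _ := isGroup.Build fiber_subgroup
  fiber_mulA fiber_mul1 fiber_mulr1 fiber_mulV fiber_mulrV.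

Lemma fiber_coord_continuous i : continuous (fiber_coord i).
Proof.
move=> x; apply: (@continuous_comp _ _ _ (val : fiber_subgroup -> _)
  (@proj {classic I} E i)).
  exact: initial_continuous.
exact: proj_continuous.
Qed.

Lemma fiber_continuous (X : topologicalType) (f : X -> fiber_subgroup) :
  (forall i, continuous (fiber_coord i \o f)) -> continuous f.
Proof.
move=> cf; apply: continuous_comp_initial => x; apply/cvg_sup => i.
apply: continuous_comp_initial; exact: cf.
Qed.

Lemma fiber_mul_continuous :
  continuous (fun x : fiber_subgroup * fiber_subgroup => x.1 * x.2).
Proof.
apply: fiber_continuous => i x.
apply: (@continuous2_cvg _ _ _ _ _ _ (fiber_coord i \o fst)
  (fiber_coord i \o snd) (fun a b => a * b)).
- exact: (@mulg_continuous (E i) (fiber_coord i x.1, fiber_coord i x.2)).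
- by apply: continuous_comp; [exact: cvg_fst|exact: fiber_coord_continuous].
- by apply: continuous_comp; [exact: cvg_snd|exact: fiber_coord_continuous].
Qed.

Lemma fiber_inv_continuous : continuous (fun x : fiber_subgroup => x^-1).
Proof.
apply: fiber_continuous => i x.
apply: (@continuous_comp _ _ _ (fiber_coord i) (fun a : E i => a^-1)).
  exact: fiber_coord_continuous.
exact: invg_continuous.
Qed.

HB.instance Definition _ := PreTopologicalGroup_isTopologicalGroup.Build
  fiber_subgroup fiber_mul_continuous fiber_inv_continuous.

Lemma fiber_set_closed : closed fiber_set.
Proof.
have -> : fiber_set = \bigcap_i \bigcap_j
    [set h : prod_topology E | eta i (h i) = eta j (h j)].
  by apply/seteqP; split => h hP; [move=> i _ j _; exact: hP|
    move=> i j; exact: (hP i Logic.I j Logic.I)].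
have ce i : continuous (fun h : prod_topology E => eta i (h i)).
  move=> h; apply: (@continuous_comp _ _ _
    (@proj {classic I} E i : prod_topology E -> E i) (eta i)).
    exact: proj_continuous.
  exact: epi_continuous.
apply: closed_bigI => i _; apply: closed_bigI => j _.
by apply: closed_equalizer; [exact: profinite_hausdorff|exact: ce|exact: ce].
Qed.

Lemma fiber_compact : compact [set: fiber_subgroup].
Proof.
have cA : compact fiber_set.
  apply: (subclosed_compact fiber_set_closed
    (@tychonoff {classic I} E (fun=> setT) (fun i => profinite_compact))).
  by [].
move=> F PF _.
pose v : fiber_subgroup -> prod_topology E := val.
have FA : (v @ F) fiber_set.
  apply: (@filterS _ F _ setT) filterT => -[h hh] _.
  exact: (set_mem hh).
have [p [Ap clp]] := cA _ _ FA.
exists (exist _ p (mem_set Ap)); split => // A B FA' [_ [[W oW <-] Wp sWB]].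
have vA : (v @ F) (v @` A).
  by apply: (@filterS _ F _ A) FA' => x Ax; exists x.
have nW : nbhs p W by exact: open_nbhs_nbhs.
have [_ [[x Ax <-] Wx]] := clp _ _ vA nW.
by exists x; split => //; exact: sWB.
Qed.

Lemma fiber_hausdorff : hausdorff_space fiber_subgroup.
Proof.
move=> x y clxy; apply: fiber_ext => i; apply: profinite_hausdorff => A B nA nB.
have [z [Az Bz]] := clxy _ _ (@fiber_coord_continuous i x _ nA)
  (@fiber_coord_continuous i y _ nB).
by exists (fiber_coord i z).
Qed.

Lemma fiber_totally_disconnected :
  totally_disconnected [set: fiber_subgroup].
Proof.
move=> x _; apply/seteqP; split => [y|y ->]; last first.
  exact: connected_component_refl.
move=> [C [Cx _ cC Cy]]; apply: fiber_ext => i.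
suff : connected_component [set: E i] (fiber_coord i x) (fiber_coord i y).
  by rewrite (@profinite_totally_disconnected (E i) (fiber_coord i x)) // => ->.
have imC : (fiber_coord i @` C) (fiber_coord i x) by exists x.
exists (fiber_coord i @` C); last by exists y.
split => //.
apply: connected_continuous_connected => //.
exact/continuous_subspaceT/fiber_coord_continuous.
Qed.

HB.instance Definition _ := TopologicalGroup_isProfinite.Build
  fiber_subgroup fiber_compact fiber_hausdorff fiber_totally_disconnected.

Section StructureMap.
Variable j : I.

Definition fiber_fun (x : fiber_subgroup) : G := eta j (fiber_coord j x).

Lemma fiber_funM : {morph fiber_fun : x y / x * y}.
Proof. by move=> x y; rewrite /fiber_fun epiM. Qed.

Lemma fiber_fun_continuous : continuous fiber_fun.
Proof.
move=> x; apply: continuous_comp; first exact: fiber_coord_continuous.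
exact: epi_continuous.
Qed.

Lemma fiber_fun_surj y : exists x, fiber_fun x = y.
Proof.
have hP i : eta i (projT1 (cid (epi_surj (eta i) y))) = y.
  exact: (projT2 (cid (epi_surj (eta i) y))).
by exists (fiber_build (fun i k => etrans (hP i) (esym (hP k)))); exact: hP.
Qed.

Definition fiber_epi : epimorphism fiber_subgroup G :=
  Epimorphism fiber_funM fiber_fun_continuous fiber_fun_surj.

End StructureMap.

End FiberSubgroup.

Definition id_epi (G : profiniteGroupType) : epimorphism G G.
Proof.
apply: (@Epimorphism G G idfun) => [//|x|y]; [exact: cvg_id|by exists y].
Defined.

Section FiberProduct.
Variables (I : Type) (G : profiniteGroupType) (E : I -> profiniteGroupType).
Variable eta : forall i, epimorphism (E i) G.

Definition fiber_product : profiniteGroupType :=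
  match pselectT I with
  | inl _ => G
  | inr _ => fiber_subgroup eta
  end.

Definition fiber_product_map : epimorphism fiber_product G :=
  match pselectT I as s return
    epimorphism (match s with inl _ => G | inr _ => fiber_subgroup eta end) G
  with
  | inl _ => id_epi G
  | inr j => fiber_epi eta j
  end.

End FiberProduct.

(* Main.v *)
From HB Require Import structures.
Require Import Defs.
From mathcomp Require Import all_boot generic_quotient.
From mathcomp Require Import all_classical topology.

(** Let K be the kernel of pi : H -> G, and call a normal subgroup of H
    maximal below K if it is a maximal element of the normal subgroups properly
    contained in K.

    If pi factors as eta \o p with p onto, then the decompositions of eta are
    the normal subgroups of H between Ker p and K.  Hence eta is indecomposable
    if and only if Ker p is maximal below K ([indecomposable_factor]).

    If H is the fiber product of indecomposable eta_i : E_i -> G, then every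
    coordinate H -> E_i is onto, so its kernel is maximal below K; an element of
    K that lies in all these kernels is trivial, so pi is fundamental
    ([fiber_product_projections]).

    Conversely let pi be fundamental.  H maps to the fiber product of the
    epimorphisms H/N -> G, N maximal below K, and this map is injective, but not
    onto in general: the family of all N can be redundant.  A family S of such N is
    called independent when K maps onto the product of the K/N, N in S.
    Compactness of H shows that the union of a chain of independent families is
    independent, so Zorn's lemma gives a maximal one, S.  Put
    M = K /\ bigcap S.  If some N' maximal below K did not contain M, then
    M N' = K by maximality of N', and any element of K/N' could be reached by
    correcting a solution for S by an element of M; so S and N' together would
    be independent, against the maximality of S.  So M is contained in all N',
    hence trivial since pi is fundamental ([max_independent_bigcap]), and H is
    the fiber product of the H/N -> G, N in S ([isomorphic_fiber_product]).

    This uses that H/N is again profinite.  The point to prove is that two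
    cosets xN, yN are separated by a clopen set.  In a compact Hausdorff space
    quasicomponents are connected, so 1 has a basis of clopen neighborhoods in
    H; each contains an open subgroup U, and for small U the union x U N of
    cosets of the open subgroup U N is clopen and misses y
    ([quotient_zero_dimensional]). *)

Set Implicit Arguments.
Unset Strict Implicit.
Unset Printing Implicit Defensive.

Local Open Scope classical_set_scope.
Local Open Scope group_scope.

(** * Compact spaces *)

(** The sets A i generate a proper filter, and a cluster point of it lies in
    each of them because they are closed. *)
Lemma compact_directed_bigcap (X : topologicalType) (I : Type) (D : set I)
    (A : I -> set X) :
  compact [set: X] -> D !=set0 ->
  (forall i j, D i -> D j -> exists2 k, D k & A k `<=` A i `&` A j) ->
  (forall i, D i -> closed (A i)) -> (forall i, D i -> A i !=set0) ->
  \bigcap_(i in D) A i !=set0.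
Proof.
move=> cX D0 dirA clA A0.
have FF := filter_from_proper (filter_from_filter D0 dirA) A0.
have [p [_ clp]] := cX _ FF filterT.
by exists p => i Di; apply: (clA i Di) => B pB; apply: clp => //; exists i.
Qed.

Section Quasicomponent.
Variables (X : topologicalType) (x : X).
Hypotheses (cX : compact [set: X]) (hX : hausdorff_space X).

Let Q := [set y : X | forall C, clopen C -> C x -> C y].

(* Otherwise the traces on the complement of W of the clopen sets containing x
   form a directed family of nonempty closed sets, with a common point in Q. *)
Let clopen_sub_open (W : set X) :
  open W -> Q `<=` W -> exists C, [/\ clopen C, C x & C `<=` W].
Proof.
move=> oW QW; apply: contrapT => noC.
pose D := [set C : set X | clopen C /\ C x].
suff [p Dp] : \bigcap_(C in D) (C `&` ~` W) !=set0.
  have [_] := Dp _ (conj clopenT Logic.I); apply; apply: QW => C cC Cx.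
  by case: (Dp C (conj cC Cx)).
apply: compact_directed_bigcap => //.
- by exists setT; split => //; exact: clopenT.
- move=> A B [cA Ax] [cB Bx]; exists (A `&` B).
    by split=> //; exact: clopenI.
  by move=> z [[]].
- by move=> C [[_ cC] _]; apply: closedI => //; exact: open_closedC.
- move=> C [cC Cx]; apply: contrapT => nC; apply: noC; exists C; split=> // z Cz.
  by apply: contrapT => Wz; apply: nC; exists z.
Qed.

(* Normality gives an open V around A whose closure misses B.  A clopen set
   around x inside V and the complement of the closure of V meets V in a clopen
   set, which contains Q by definition. *)
Let quasicomponent_side (A B : set X) : closed A -> closed B ->
  A `&` B = set0 -> Q `<=` A `|` B -> A x -> Q `<=` A.
Proof.
move=> cA cB AB0 QAB Ax.
have nAB : set_nbhs A (~` B).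
  apply/set_nbhsP; exists (~` B); split=> //; first exact: closed_openC.
  by move=> z Az Bz; have : (A `&` B) z by []; rewrite AB0.
have [U /set_nbhsP[V [oV AV VU]] clU] := compact_normal hX cX cA nAB.
have BV z : B z -> ~ closure V z by move=> Bz /(closureS VU)/clU.
have [C [[oC cC] Cx CW]] : exists C,
    [/\ clopen C, C x & C `<=` V `|` ~` closure V].
  apply: clopen_sub_open.
    by apply: openU => //; apply: closed_openC; exact: closed_closure.
  by move=> z /QAB[/AV|/BV]; [left|right].
have cCV : clopen (C `&` V).
  split; first exact: openI.
  suff -> : C `&` V = C `&` closure V by apply: closedI => //; exact: closed_closure.
  apply/seteqP; split=> z [Cz Vz]; split=> //; first exact: subset_closure.
  by case: (CW z Cz).
move=> y Qy; have [//|/BV[]] := QAB y Qy.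
by apply: subset_closure; have [] := Qy _ cCV (conj Cx (AV _ Ax)).
Qed.

Let quasicomponent_closed : closed Q.
Proof.
have -> : Q = \bigcap_(C in [set C | clopen C /\ C x]) C.
  by apply/seteqP; split=> y Qy C; [case; exact: Qy|move=> ? ?; exact: Qy].
by apply: closed_bigI => C [[]].
Qed.

(** If a relatively clopen part B of Q contains x then it contains Q; if it does
    not, then Q is contained in the complement of B, and B is empty. *)
Lemma quasicomponent_connected : connected Q.
Proof.
move=> B [b Bb] [O oO BO] [C cC BC].
have BQ : B `<=` Q by rewrite BC => z [].
have cB : closed B by rewrite BC; exact: closedI.
have cD : closed (Q `&` ~` O) by apply: closedI => //; exact: open_closedC.
have BD0 : B `&` (Q `&` ~` O) = set0.
  by apply/seteqP; split=> // z [Bz [_]]; apply; move: Bz; rewrite BO => -[].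
have QBD : Q `<=` B `|` (Q `&` ~` O).
  by move=> z Qz; have [Oz|Oz] := pselect (O z); [left; rewrite BO|right].
have Qx : Q x by [].
have [Bx|Dx] := QBD x Qx.
  by apply/seteqP; split=> //; exact: (quasicomponent_side cB cD).
have QD : Q `<=` Q `&` ~` O.
  by apply: quasicomponent_side cD cB _ _ Dx; [rewrite setIC|rewrite setUC].
have : (B `&` (Q `&` ~` O)) b by split=> //; exact: QD (BQ _ Bb).
by rewrite BD0.
Qed.

End Quasicomponent.

(** The quasicomponent of x, being connected, is contained in its component,
    which is x alone. *)
Lemma totally_disconnected_zero_dimensional (X : topologicalType) :
  compact [set: X] -> hausdorff_space X -> totally_disconnected [set: X] ->
  zero_dimensional X.
Proof.
move=> cX hX tX x y /eqP xy; apply: contrapT => noC; apply: xy.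
suff : connected_component [set: X] x y by rewrite tX // => ->.
exists [set y : X | forall C, clopen C -> C x -> C y]; last first.
  move=> C cC Cx; apply: contrapT => Cy; apply: noC; by exists C.
by split => //; exact: quasicomponent_connected.
Qed.

(** * Translations and open subgroups *)

Section Translations.
Variable H : topologicalGroupType.

Lemma mulg_continuousl (a : H) : continuous (fun x : H => a * x).
Proof.
move=> x; apply: (@continuous2_cvg _ _ _ _ _ _ (fun=> a) id (fun a b => a * b)).
- exact: (@mulg_continuous H (a, x)).
- exact: cvg_cst.
- exact: cvg_id.
Qed.

Lemma mulg_continuousr (a : H) : continuous (fun x : H => x * a).
Proof.
move=> x; apply: (@continuous2_cvg _ _ _ _ _ _ id (fun=> a) (fun a b => a * b)).
- exact: (@mulg_continuous H (x, a)).
- exact: cvg_id.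
- exact: cvg_cst.
Qed.

(** A union of left cosets of an open subgroup is open, and so is its complement,
    which is again such a union. *)
Lemma open_subgroup_translates (U C : set H) :
  (forall x y, U x -> U y -> U (x * y)) ->
  (forall x, U x -> U x^-1) -> nbhs 1 U ->
  (forall c u, C c -> U u -> C (c * u)) -> clopen C.
Proof.
move=> UM UV nU CU.
have oCU D : (forall c u, D c -> U u -> D (c * u)) -> open D.
  move=> DU; rewrite openE => x Dx.
  have nx : nbhs x [set y | U (x^-1 * y)].
    by have := @mulg_continuousl x^-1 x U; rewrite mulVg; exact.
  by apply: filterS nx => y /(DU _ _ Dx); rewrite mulVKg.
split; first exact: oCU.
rewrite -[C]setCK; apply: open_closedC; apply: oCU => c u Cc Uu Ccu; apply: Cc.
by rewrite -(mulgK u c); apply: CU => //; exact: UV.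
Qed.

End Translations.

(** Inside W there is a clopen A containing 1.  The stabilizer U of A under right
    translations is contained in A, since 1 is in A, and it is a neighborhood
    of 1 by the tube lemma, since A is compact and open. *)
Lemma open_subgroup_basis (H : profiniteGroupType) (W : set H) : nbhs 1 W ->
  exists U : set H, [/\ forall x y, U x -> U y -> U (x * y),
    forall x, U x -> U x^-1, nbhs 1 U & U `<=` W].
Proof.
move=> nW.
have zH := totally_disconnected_zero_dimensional (@profinite_compact H)
  (@profinite_hausdorff H) (@profinite_totally_disconnected H).
have [A [A1 [oA cA]] AW] :=
  zero_dimensional_cvg (@profinite_hausdorff H) zH (@profinite_compact H) nW.
pose U := [set u : H | forall a, A a -> A (a * u) /\ A (a * u^-1)].
exists U; split.
- move=> x y Ux Uy a Aa; rewrite invgM !mulgA.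
  by split; [have [/Uy[]] := Ux a Aa|have [_ /Ux[]] := Uy a Aa].
- by move=> x Ux a /Ux[]; rewrite invgK.
- have cptA : compact A := subclosed_compact cA (@profinite_compact H) (subsetT A).
  (* The near-covering form of compactness is the tube lemma for A. *)
  have /compact_near_coveringP/(_ _ (nbhs (1 : H))
    (fun u a => A (a * u) /\ A (a * u^-1)) _) nc := cptA.
  apply: nc => a Aa.
  have c1 : (fun z : H * H => z.1 * z.2) @ (a, 1 : H) --> a * 1.
    exact: (@mulg_continuous H (a, 1)).
  have c2 : (fun z : H * H => z.1 * z.2^-1) @ (a, 1 : H) --> a * 1^-1.
    apply: (@continuous2_cvg _ _ _ _ _ _ fst (fun z => z.2^-1) (fun a b => a * b)).
    - exact: (@mulg_continuous H (a, 1^-1)).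
    - exact: cvg_fst.
    - apply: (@cvg_comp _ _ _ snd (fun z : H => z^-1) _ (nbhs (1 : H))).
        exact: cvg_snd.
      exact: invg_continuous.
  have nAa : nbhs a A by exact: open_nbhs_nbhs.
  rewrite invg1 mulg1 in c2; rewrite mulg1 in c1.
  have nA : nbhs (a, 1 : H) [set z : H * H | A (z.1 * z.2) /\ A (z.1 * z.2^-1)].
    by apply: filterI; [exact: c1|exact: c2].
  exact: nA.
- by move=> u /(_ _ A1)[]; rewrite mul1g => /AW.
Qed.

(** * Quotients by closed normal subgroups *)

Section Quotient.
Variables (H : profiniteGroupType) (N : set H) (nN : normal_subgroup N).

Let N1 : N 1. Proof. by case: nN. Qed.
Let NM x y : N x -> N y -> N (x * y).
Proof. by case: nN => ? + _ _ _; exact. Qed.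
Let NV x : N x -> N x^-1.
Proof. by case: nN => ? ? + _ _; exact. Qed.
Let NJ x y : N x -> N (x ^ y).
Proof. by case: nN => ? ? ? + _; exact. Qed.

Definition coset_rel : rel H := fun x y => `[< N (x^-1 * y) >].

Lemma coset_rel_equiv : equiv_class_of coset_rel.
Proof.
split => [x|x y|y x z].
- by apply/asboolP; rewrite mulVg; exact: N1.
- by apply/asboolP/asboolP => /NV; rewrite invgM invgK.
- move=> /asboolP xy /asboolP yz; apply/asboolP.
  by have := NM xy yz; rewrite -mulgA mulVKg.
Qed.

Definition coset_equiv : equiv_rel H := EquivRelPack coset_rel_equiv.

(** The quotient depends on the proof that N is normal, so that it can carry
    canonical group and topological structures. *)
Definition quotient_group : Type := quotient_topology {eq_quot coset_equiv}%qT.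

HB.instance Definition _ := Topological.on quotient_group.
HB.instance Definition _ := Quotient.on quotient_group.

Definition coset (x : H) : quotient_group := (\pi_quotient_group x)%qT.

Lemma coset_repr (q : quotient_group) : coset (repr q) = q.
Proof. exact: reprK. Qed.

Lemma coset_eqP x y : coset x = coset y <-> N (x^-1 * y).
Proof. by split=> [/eqmodP/asboolP//|xy]; apply/eqmodP/asboolP. Qed.

Lemma coset_surj (q : quotient_group) : exists x, coset x = q.
Proof. by exists (repr q); exact: coset_repr. Qed.

Lemma coset_continuous : continuous coset.
Proof. exact: pi_continuous. Qed.

Lemma coset_eqM x x' y y' :
  coset x = coset x' -> coset y = coset y' -> coset (x * y) = coset (x' * y').
Proof.
move=> /coset_eqP xx /coset_eqP yy; apply/coset_eqP.
have := NM (NJ y xx) yy.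
by rewrite conjgE invgM -!mulgA mulVKg.
Qed.

Lemma coset_eqV x x' : coset x = coset x' -> coset x^-1 = coset x'^-1.
Proof.
move=> /coset_eqP /NV/(NJ x^-1) xx; apply/coset_eqP.
by move: xx; rewrite conjgE invgM !invgK -!mulgA mulgV mulg1.
Qed.

Definition quotient_one : quotient_group := coset 1.
Definition quotient_inv (p : quotient_group) : quotient_group :=
  coset (repr p)^-1.
Definition quotient_mul (p q : quotient_group) : quotient_group :=
  coset (repr p * repr q).

Lemma quotient_mulE x y : quotient_mul (coset x) (coset y) = coset (x * y).
Proof. by apply: coset_eqM; exact: coset_repr. Qed.

Lemma quotient_invE x : quotient_inv (coset x) = coset x^-1.
Proof. by apply: coset_eqV; exact: coset_repr. Qed.

Lemma quotient_mulA : associative quotient_mul.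
Proof.
move=> p q r; have [x <-] := coset_surj p; have [y <-] := coset_surj q.
by have [z <-] := coset_surj r; rewrite !quotient_mulE mulgA.
Qed.
Lemma quotient_mul1 : left_id quotient_one quotient_mul.
Proof. by move=> p; have [x <-] := coset_surj p; rewrite quotient_mulE mul1g. Qed.
Lemma quotient_mulr1 : right_id quotient_one quotient_mul.
Proof. by move=> p; have [x <-] := coset_surj p; rewrite quotient_mulE mulg1. Qed.
Lemma quotient_mulV : left_inverse quotient_one quotient_inv quotient_mul.
Proof.
move=> p; have [x <-] := coset_surj p.
by rewrite quotient_invE quotient_mulE mulVg.
Qed.
Lemma quotient_mulrV : right_inverse quotient_one quotient_inv quotient_mul.
Proof.
move=> p; have [x <-] := coset_surj p.
by rewrite quotient_invE quotient_mulE mulgV.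
Qed.

HB.instance Definition _ := isGroup.Build quotient_group
  quotient_mulA quotient_mul1 quotient_mulr1 quotient_mulV quotient_mulrV.

Lemma cosetM : {morph coset : x y / x * y}.
Proof. by move=> x y; exact: esym (quotient_mulE x y). Qed.

Lemma cosetV : {morph coset : x / x^-1}.
Proof. by move=> x; exact: esym (quotient_invE x). Qed.

(** The saturation of A is the union of its translates by elements of N. *)
Lemma coset_open (A : set H) : open A -> open (coset @` A).
Proof.
move=> oA; suff : open (coset @^-1` (coset @` A)) by move=> o; exact: o.
have -> : coset @^-1` (coset @` A) =
    \bigcup_(n in N) ((fun x => x * n) @^-1` A).
  apply/seteqP; split=> [x [a Aa /esym/coset_eqP ax]|x [n Nn Axn]].
    by exists (x^-1 * a) => //=; rewrite mulVKg.
  by exists (x * n) => //; apply/esym/coset_eqP; rewrite mulKg.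
apply: bigcup_open => n _; apply: open_comp => // x _.
exact: mulg_continuousr.
Qed.

Lemma coset_nbhs x (A : set H) : nbhs x A -> nbhs (coset x) (coset @` A).
Proof.
rewrite nbhsE => -[B [oB Bx] BA]; have nB : nbhs (coset x) (coset @` B).
  by apply: open_nbhs_nbhs; split; [exact: coset_open|exists x].
apply: filterS nB; exact: image_subset.
Qed.

(** Continuity descends from H since the projection is open. *)
Lemma quotient_mul_continuous :
  continuous (fun z : quotient_group * quotient_group => z.1 * z.2).
Proof.
move=> [p q]; have [x <-] := coset_surj p; have [y <-] := coset_surj q.
move=> W /=; rewrite -cosetM => /coset_continuous nW.
have [[A B] /= [nA nB] AB] := @mulg_continuous H (x, y) _ nW.
exists (coset @` A, coset @` B) => /=.
  by split; exact: coset_nbhs.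
move=> [_ _] /= [[a Aa <-] [b Bb <-]]; rewrite -cosetM.
by apply: (AB (a, b)).
Qed.

Lemma quotient_inv_continuous : continuous (fun p : quotient_group => p^-1).
Proof.
move=> p; have [x <-] := coset_surj p.
move=> W /=; rewrite -cosetV => /coset_continuous nW.
have nA := @invg_continuous H x _ nW.
by apply: (filterS _ (coset_nbhs nA)) => _ [a Wa <-] /=; rewrite -cosetV.
Qed.

HB.instance Definition _ := PreTopologicalGroup_isTopologicalGroup.Build
  quotient_group quotient_mul_continuous quotient_inv_continuous.

Lemma quotient_compact : compact [set: quotient_group].
Proof.
have -> : [set: quotient_group] = coset @` [set: H].
  by apply/seteqP; split=> // q _; have [x <-] := coset_surj q; exists x.
apply: continuous_compact; last exact: profinite_compact.
exact/continuous_subspaceT/coset_continuous.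
Qed.

(** As x^-1 y is not in the closed set N, a small open subgroup U satisfies
    x^-1 y U /\ N = 0.  Then x U N misses y, and its image is a union of cosets
    of the open subgroup U N / N of the quotient. *)
Lemma quotient_zero_dimensional : zero_dimensional quotient_group.
Proof.
move=> p q; have [x <-] := coset_surj p; have [y <-] := coset_surj q.
move=> /eqP xy.
have nz : nbhs (1 : H) [set u | ~ N (x^-1 * y * u)].
  have cN : closed N by case: nN.
  have := @mulg_continuousl H (x^-1 * y) 1 (~` N); rewrite mulg1; apply.
  apply: open_nbhs_nbhs; split; first exact: closed_openC.
  by move=> /coset_eqP.
have [U [UM UV nU UN]] := open_subgroup_basis nz.
have cnU : nbhs 1 (coset @` U) := coset_nbhs nU.
exists [set coset (x * u) | u in U]; split.
- apply: (@open_subgroup_translates _ (coset @` U)) => //.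
  + move=> _ _ [u Uu <-] [v Uv <-]; exists (u * v); first exact: UM.
    exact: cosetM.
  + by move=> _ [u Uu <-]; exists u^-1; [exact: UV|exact: cosetV].
  + move=> _ _ [u Uu <-] [v Uv <-]; exists (u * v); first exact: UM.
    by rewrite -cosetM mulgA.
- by exists 1; [exact: nbhs_singleton nU|rewrite mulg1].
- move=> [u Uu] /coset_eqP xuy; apply: (UN _ (UV _ Uu)).
  have := NJ u^-1 xuy.
  by rewrite conjgE invgK invgM -!mulgA mulVKg.
Qed.

Lemma quotient_hausdorff : hausdorff_space quotient_group.
Proof.
move=> p q clpq; apply: contrapT => /eqP/quotient_zero_dimensional.
move=> [U [[oU cU] Up Uq]].
have nU : nbhs p U by exact: open_nbhs_nbhs.
have nUq : nbhs q (~` U) by apply: open_nbhs_nbhs; split=> //; exact: closed_openC.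
by have [z []] := clpq _ _ nU nUq.
Qed.

HB.instance Definition _ := TopologicalGroup_isProfinite.Build quotient_group
  quotient_compact quotient_hausdorff
  (zero_dimension_totally_disconnected quotient_zero_dimensional).

Definition quotient_epi : epimorphism H quotient_group :=
  Epimorphism cosetM coset_continuous coset_surj.

Lemma kernel_quotient_epi : kernel quotient_epi = N.
Proof.
apply/seteqP; split=> x.
  by move=> /esym/coset_eqP; rewrite invg1 mul1g.
by move=> Nx; apply/esym/coset_eqP; rewrite invg1 mul1g.
Qed.

End Quotient.

(** * Epimorphisms and their kernels *)

Lemma epi_eqP (H G : profiniteGroupType) (f : epimorphism H G) x y :
  f x = f y <-> kernel f (x^-1 * y).
Proof.
rewrite /kernel /= epiM epiV; split=> [->|/mulg1_eq]; first by rewrite mulVg.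
by rewrite invgK.
Qed.

Lemma kernel_normal (H G : profiniteGroupType) (f : epimorphism H G) :
  normal_subgroup (kernel f).
Proof.
split; rewrite /kernel /=.
- exact: epi1.
- by move=> x y fx fy; rewrite epiM fx fy mulg1.
- by move=> x fx; rewrite epiV fx invg1.
- by move=> x y fx; rewrite conjgE !epiM fx mul1g epiV mulVg.
- apply: (@closed_equalizer _ _ f (fun=> 1)).
  + exact: profinite_hausdorff.
  + exact: epi_continuous.
  + by move=> x; exact: cvg_cst.
Qed.

(** Compactness makes epimorphisms closed maps, hence topological quotient maps;
    this is where continuity of induced maps and inverses comes from. *)
Lemma epi_closed (H G : profiniteGroupType) (f : epimorphism H G) (A : set H) :
  closed A -> closed (f @` A).
Proof.
move=> cA; apply: compact_closed; first exact: profinite_hausdorff.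
apply: continuous_compact; first exact/continuous_subspaceT/epi_continuous.
exact: subclosed_compact cA (@profinite_compact H) _.
Qed.

Definition comp_epi (H K G : profiniteGroupType) (g : epimorphism K G)
  (f : epimorphism H K) : epimorphism H G.
Proof.
apply: (@Epimorphism H G (g \o f)).
- by move=> x y /=; rewrite !epiM.
- by move=> x; apply: continuous_comp; exact: epi_continuous.
- by move=> z; have [y <-] := epi_surj g z; have [x <-] := epi_surj f y; exists x.
Defined.

Lemma epi_factor (H Q G : profiniteGroupType) (q : epimorphism H Q)
    (f : epimorphism H G) :
  kernel q `<=` kernel f -> exists g : epimorphism Q G, f =1 g \o q.
Proof.
move=> qf; have [s qs] := choice (epi_surj q).
have fs x : f (s (q x)) = f x by apply/epi_eqP/qf/epi_eqP; rewrite qs.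
have gM : {morph f \o s : x y / x * y}.
  by move=> x y /=; rewrite -epiM -[RHS]fs epiM !qs.
have gc : continuous (f \o s).
  apply/continuous_closedP => A cA.
  have -> : (f \o s) @^-1` A = q @` (f @^-1` A).
    apply/seteqP; split=> [y Ay|_ [x Ax <-]]; first by exists (s y).
    by rewrite /= fs.
  apply: epi_closed; move/continuous_closedP: (@epi_continuous _ _ f); exact.
have gs y : exists x, (f \o s) x = y.
  by have [x <-] := epi_surj f y; exists (q x); rewrite /= fs.
by exists (Epimorphism gM gc gs) => x; rewrite /= fs.
Qed.

Lemma isomorphism_kernel (H G : profiniteGroupType) (f : epimorphism H G) :
  isomorphism f <-> kernel f = [set 1].
Proof.
split=> [[_ _ [g [fK _ _]]]|kf].
  apply/seteqP; split=> x /=; last by move=> ->; exact: epi1.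
  by move=> fx; rewrite -(fK x) fx -(epi1 f) fK.
have [|g fK] := @epi_factor _ _ _ f (id_epi H); first by rewrite kf.
split; [exact: epiM|exact: epi_continuous|exists g; split=> //].
- by move=> x; exact: esym (fK x).
- by move=> y; have [x <-] := epi_surj f y; have /= <- := fK x.
- exact: epi_continuous.
Qed.

(** For p onto, the kernel of eta is the image of that of pi; so eta is
    injective when the kernel of pi is no larger than that of p. *)
Lemma isomorphism_factor (H E G : profiniteGroupType) (pi : epimorphism H G)
    (p : epimorphism H E) (eta : epimorphism E G) : pi =1 eta \o p ->
  isomorphism eta <-> kernel p = kernel pi.
Proof.
move=> pip; rewrite isomorphism_kernel; split=> [ke|kp].
  apply/seteqP; split=> x; rewrite /kernel /= pip /=.
    by move=> ->; exact: epi1.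
  by move=> ex; have : kernel eta (p x) by []; rewrite ke.
apply/seteqP; split=> y /=; last by move=> ->; exact: epi1.
have [x <-] := epi_surj p y => ex.
have kx : kernel pi x by rewrite /kernel /= pip.
by move: kx; rewrite -kp.
Qed.

Lemma kernel_factor_sub (H E G : profiniteGroupType) (pi : epimorphism H G)
    (p : epimorphism H E) (eta : epimorphism E G) : pi =1 eta \o p ->
  kernel p `<=` kernel pi.
Proof. by move=> pip x; rewrite /kernel /= pip /= => ->; exact: epi1. Qed.

(** By the homomorphism theorem, decompositions E -> K -> G of eta correspond to
    normal subgroups N of H between Ker p and Ker pi: take K = H/N, and
    conversely N the kernel of H -> E -> K.  The two factors are isomorphisms
    when N = Ker p, respectively N = Ker pi. *)
Lemma indecomposable_factor (H E G : profiniteGroupType) (pi : epimorphism H G)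
    (p : epimorphism H E) (eta : epimorphism E G) : pi =1 eta \o p ->
  indecomposable eta <-> max_normal_in (kernel pi) (kernel p).
Proof.
move=> pip; have psub := kernel_factor_sub pip.
split=> [[niso ndec]|[_ [_ npsub] maxp]]; split.
- exact: kernel_normal.
- split=> // subp; apply: niso; apply/(isomorphism_factor pip).
  exact/seteqP.
- move=> N nN [Nsub nsubN] pN.
  pose q := quotient_epi nN; have kq : kernel q = N := kernel_quotient_epi nN.
  have [|f qf] := @epi_factor _ _ _ p q; first by rewrite kq.
  have [|g pig] := @epi_factor _ _ _ q pi; first by rewrite kq.
  apply: contrapT => nNp; apply: ndec; exists _, f, g; split.
  + move=> y; have [x <-] := epi_surj p y; rewrite -[LHS]pip pig.
    exact (congr1 (epi_fun g) (qf x)).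
  + by move=> /(isomorphism_factor qf) kpq; apply: nNp; rewrite kpq.
  + by move=> /(isomorphism_factor pig) kqp; apply: nsubN; rewrite -kqp kq.
- by move=> /(isomorphism_factor pip) kp; apply: npsub; rewrite kp.
- move=> [K [f [g [etagf nf ng]]]].
  have pig : pi =1 g \o comp_epi f p by move=> x; rewrite pip /= etagf.
  have pK : kernel p `<=` kernel (comp_epi f p) by exact: kernel_factor_sub (f) _.
  have Ksub : kernel (comp_epi f p) `<=` kernel pi := kernel_factor_sub pig.
  have nKsub : ~ kernel pi `<=` kernel (comp_epi f p).
    by move=> piK; apply: ng; apply/(isomorphism_factor pig)/seteqP.
  apply: nf; apply/(@isomorphism_factor _ _ _ (comp_epi f p) p f) => //.
  by rewrite (maxp _ (kernel_normal _) (conj Ksub nKsub) pK).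
Qed.

(** * Recognizing fiber products *)

Section FiberProduct.
Variables (I : Type) (G : profiniteGroupType) (E : I -> profiniteGroupType).
Variable eta : forall i, epimorphism (E i) G.

(** Complete e by arbitrary preimages of eta i e in the other coordinates.  As I
    is a bare type, the value at j = i is prescribed by transport along every
    proof of i = j. *)
Lemma fiber_coord_surj i (e : E i) :
  exists x : fiber_subgroup eta, fiber_coord i x = e.
Proof.
have ex j : exists y : E j,
    eta j y = eta i e /\ forall ij : i = j, y = ecast k (E k) ij e.
  have [ij|nij] := pselect (i = j).
    by case: j / ij; exists e; split=> // ij; rewrite (Prop_irrelevance ij erefl).
  by have [y yP] := epi_surj (eta j) (eta i e); exists y.
pose h j := projT1 (cid (ex j)); have hP j := projT2 (cid (ex j)).
have hh j k : eta j (h j) = eta k (h k) by rewrite (hP j).1 (hP k).1.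
by exists (fiber_build hh); exact: (hP i).2 erefl.
Qed.

Lemma fiber_coordM i : {morph @fiber_coord I G E eta i : x y / x * y}.
Proof. by []. Qed.

Definition fiber_coord_epi i : epimorphism (fiber_subgroup eta) (E i) :=
  Epimorphism (@fiber_coordM i) (@fiber_coord_continuous _ _ _ eta i)
    (@fiber_coord_surj i).

(** The maps p i are the coordinates.  For empty I there are none, but then
    pi itself is an isomorphism; this is why h is also taken in its kernel. *)
Lemma fiber_product_projections (H : profiniteGroupType)
    (pi : epimorphism H G) :
  isomorphic_over pi (fiber_product_map eta) ->
  exists p : forall i, epimorphism H (E i),
    (forall i, pi =1 eta i \o p i) /\
    (forall h, kernel pi h -> (forall i, kernel (p i) h) -> h = 1).
Proof.
rewrite /fiber_product_map /fiber_product.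
case: (pselectT I) => [nI|j] [psi [psiM psic [phi [psiK phiK phic]]] pipsi].
  exists (fun i => False_rect _ (nI i)); split=> [i|h pih _]; first by case: nI.
  apply: (can_inj psiK); rewrite -[psi h]pipsi pih.
  by apply: (mulgI (psi 1)); rewrite -psiM !mulg1.
have psiS y : exists x, psi x = y by exists (phi y).
pose p i := comp_epi (fiber_coord_epi i) (Epimorphism psiM psic psiS).
exists p; split=> [i h|h _ ph].
  by rewrite pipsi /=; exact: fiber_coordP.
apply: (can_inj psiK); apply: fiber_ext => i; rewrite [LHS](ph i).
by rewrite [RHS](epi1 (p i)).
Qed.

(** A point y of the fiber product is hit as follows: choose h0 over the image of
    y in G, and h i in H with p i (h i) = y i.  The elements h0^-1 h i lie in
    the kernel of pi, and the last hypothesis approximates all of them by a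
    single k; then h0 k is sent to y. *)
Lemma isomorphic_fiber_product (H : profiniteGroupType)
    (pi : epimorphism H G) (p : forall i, epimorphism H (E i)) :
  (forall i, pi =1 eta i \o p i) ->
  (forall h, kernel pi h -> (forall i, kernel (p i) h) -> h = 1) ->
  (forall x : I -> H, (forall i, kernel pi (x i)) ->
     exists2 k, kernel pi k & forall i, p i k = p i (x i)) ->
  isomorphic_over pi (fiber_product_map eta).
Proof.
move=> pip pinj psurj; rewrite /fiber_product_map /fiber_product.
case: (pselectT I) => [nI|j].
  exists pi => //; apply/isomorphism_kernel/seteqP.
  split=> h; last by move=> ->; exact: epi1.
  by move=> pih; apply: pinj => // i; case: nI.
have pP h i k : eta i (p i h) = eta k (p k h).
  exact: etrans (esym (pip i h)) (pip k h).
pose psi h := fiber_build (pP h).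
have psiM : {morph psi : x y / x * y}.
  by move=> x y; apply: fiber_ext => i; exact: epiM.
have psic : continuous psi.
  by apply: fiber_continuous => i; exact: (@epi_continuous _ _ (p i)).
have psiS y : exists x, psi x = y.
  have [h0 ph0] := epi_surj pi (eta j (fiber_coord j y)).
  have [h hP] := choice (fun i => epi_surj (p i) (fiber_coord i y)).
  have hker i : kernel pi (h0^-1 * h i).
    by apply/epi_eqP; rewrite ph0 [RHS](pip i) /= hP; exact: fiber_coordP.
  have [k _ kP] := psurj _ hker; exists (h0 * k); apply: fiber_ext => i.
  by rewrite [LHS]epiM kP -epiM mulVKg.
exists psi; last by move=> h; exact: (pip j).
apply/(@isomorphism_kernel _ _ (Epimorphism psiM psic psiS))/seteqP.
split=> h; last by move=> ->; exact: epi1.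
move=> psih; have ph i : p i h = 1 by exact (congr1 (fiber_coord i) psih).
by apply: pinj => //; rewrite /kernel /= (pip j) /= ph epi1.
Qed.

End FiberProduct.

(** * Independent families of maximal normal subgroups *)

Section Independent.
Variables (H : profiniteGroupType) (K : set H).
Hypothesis nK : normal_subgroup K.

(** The second condition is surjectivity of K -> prod (K/N), N in S, phrased with
    representatives so that no quotient is formed. *)
Definition independent (S : set (set H)) : Prop :=
  S `<=` max_normal_in K /\
  forall x : set H -> H, (forall N, S N -> K (x N)) ->
    exists2 k, K k & forall N, S N -> N ((x N)^-1 * k).

(** For each S in the chain, the solutions k for the members of S form a nonempty
    closed set, and these sets are nested. *)
Lemma independent_chain (F : set (set (set H))) :
  F `<=` independent -> total_on F subset ->
  independent (\bigcup_(S in F) S).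
Proof.
move=> Find Ftot; split=> [N [S FS SN]|x Kx].
  by have [+ _] := Find S FS; exact.
have [F0|/set0P Fn0] := eqVneq F set0.
  by exists 1; [case: nK|move=> N [S]; rewrite F0].
pose A S := K `&` [set k | forall N, S N -> N ((x N)^-1 * k)].
suff [k kA] : \bigcap_(S in F) A S !=set0.
  by have [S FS] := Fn0; exists k => [|N [T FT]];
    [have [] := kA S FS|have [_ +] := kA T FT; exact].
have AS S T : S `<=` T -> A T `<=` A S.
  by move=> ST k [Kk kT]; split=> // N /ST; exact: kT.
apply: compact_directed_bigcap => //.
- exact: profinite_compact.
- move=> S T FS FT; have [ST|TS] := Ftot S T FS FT.
    by exists T => // k Ak; split=> //; exact: AS ST _ Ak.
  by exists S => // k Ak; split=> //; exact: AS TS _ Ak.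
- move=> S FS; apply: closedI; first by case: nK.
  have -> : [set k | forall N, S N -> N ((x N)^-1 * k)] =
      \bigcap_(N in S) ((fun k => (x N)^-1 * k) @^-1` N) by [].
  apply: closed_bigI => N SN; apply: preimage_closed => [k _|].
    exact: mulg_continuousl.
  by have [+ _] := Find S FS; move=> /(_ N SN)[[]].
- move=> S FS; have [_ /(_ x)[N SN|k Kk kP]] := Find S FS; last by exists k.
  by apply: Kx; exists S.
Qed.

Lemma mul_normal_subgroup (M N : set H) :
  normal_subgroup M -> normal_subgroup N ->
  normal_subgroup [set z.1 * z.2 | z in M `*` N].
Proof.
move=> [M1 MM MV MJ cM] [N1 NM NV NJ cN]; split.
- by exists (1, 1); rewrite //= mulg1.
- move=> _ _ [[a b] /= [Ma Nb] <-] [[c d] /= [Mc Nd] <-].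
  exists (a * c, b ^ c * d) => /=;
    first by split; [exact: MM|apply: NM => //; exact: NJ].
  by rewrite conjgE !mulgA mulgK.
- move=> _ [[a b] /= [Ma Nb] <-]; exists (a^-1, b^-1 ^ a^-1) => /=.
    by split; [exact: MV|apply/NJ/NV].
  by rewrite conjgE invgM invgK mulKg.
- move=> _ y [[a b] /= [Ma Nb] <-]; exists (a ^ y, b ^ y) => /=.
    by split; [exact: MJ|exact: NJ].
  by rewrite conjMg.
- apply: compact_closed; first exact: profinite_hausdorff.
  apply: continuous_compact.
    exact/continuous_subspaceT/mulg_continuous.
  by apply: compact_setX; apply: (subclosed_compact _ (@profinite_compact H)).
Qed.

Lemma max_independent : exists S, independent S /\
  forall T, S `<` T -> ~ independent T.
Proof. by apply: Zorn_bigcup => F; exact: independent_chain. Qed.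

(** If h lies in M = K /\ bigcap S but not in N', then M N' = K by maximality of
    N'.  Given targets x N for N in S and x N', take k for those in S and write
    k^-1 (x N') = m n with m in M, n in N'; then k m is right for N' as well,
    and still right for S as m lies in all members of S. *)
Lemma max_independent_bigcap (S : set (set H)) :
  independent S -> (forall T, S `<` T -> ~ independent T) ->
  K `&` \bigcap_(N in S) N `<=` K `&` \bigcap_(N in max_normal_in K) N.
Proof.
move=> [Smax Sind] maxS h [Kh hS]; split=> // N' maxN'.
apply: contrapT => N'h.
have [nN' [N'K KN'] maxN'P] := maxN'.
have [K1 KM KV KJ cK] := nK; have [N'1 N'M N'V N'J cN'] := nN'.
pose M := K `&` \bigcap_(N in S) N.
have nM : normal_subgroup M.
  split.
  - by split=> // N /Smax[[]].
  - move=> x y [Kx xS] [Ky yS]; split; first exact: KM.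
    move=> N SN; have [[_ NM _ _ _] _ _] := Smax N SN.
    by apply: NM; [exact: xS|exact: yS].
  - move=> x [Kx xS]; split; first exact: KV.
    by move=> N SN; have [[_ _ NV _ _] _ _] := Smax N SN; apply: NV; exact: xS.
  - move=> x y [Kx xS]; split; first exact: KJ.
    by move=> N SN; have [[_ _ _ NJ _] _ _] := Smax N SN; apply: NJ; exact: xS.
  - by apply: closedI => //; apply: closed_bigI => N /Smax[[]].
have MN'K : K `<=` [set z.1 * z.2 | z in M `*` N'].
  apply: contrapT => KMN'.
  have MN'N' : [set z.1 * z.2 | z in M `*` N'] = N'.
    apply: maxN'P; first exact: mul_normal_subgroup.
      split=> // _ [[a b] /= [[Ka _] N'b] <-]; apply: KM => //; exact: N'K.
    by move=> n N'n; exists (1, n); rewrite /= ?mul1g //; split=> //; case: nM.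
  by apply: N'h; rewrite -MN'N'; exists (h, 1) => //=; rewrite mulg1.
apply: (maxS (S `|` [set N'])).
  split; first by move=> N; left.
  by move=> /(_ N' (or_intror erefl)) SN'; apply: N'h; exact: hS.
split=> [N [/Smax//|->//]|x Kx].
have [N SN|k Kk kP] := Sind x; first by apply: Kx; left.
have Kx' : K (x N') by apply: Kx; right.
have [[m n] /= [[Km mS] N'n] mn] := MN'K _ (KM _ _ (KV _ Kk) Kx').
exists (k * m); first exact: KM.
move=> N [SN|->].
  have [[_ NM _ _ _] _ _] := Smax N SN.
  by rewrite mulgA; apply: NM; [exact: kP|exact: mS].
have -> : (x N')^-1 * (k * m) = n^-1; last exact: N'V.
by apply: invg_inj; rewrite !invgM !invgK -mulgA -mn mulKg.
Qed.

End Independent.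

(** * Fundamental epimorphisms are the fiber products of indecomposable ones *)

Theorem corollary8p6 (H G : profiniteGroupType) (pi : epimorphism H G) :
  fundamental pi <->
  exists (I : Type) (E : I -> profiniteGroupType)
    (eta : forall i : I, epimorphism (E i) G),
    (forall i : I, indecomposable (eta i)) /\
    isomorphic_over pi (fiber_product_map eta).
Proof.
split=> [fund|[I [E [eta [ind /fiber_product_projections[p [pip pinj]]]]]]].
  have [S [indS maxS]] := max_independent (kernel_normal pi).
  have [Smax Sx] := indS.
  pose I := {N : set H | S N}.
  have nI (i : I) : normal_subgroup (sval i) by have [] := Smax _ (svalP i).
  pose p (i : I) := quotient_epi (nI i).
  have kp i : kernel (p i) = sval i := kernel_quotient_epi (nI i).
  have ex i : exists f : epimorphism (quotient_group (nI i)) G, pi =1 f \o p i.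
    by apply: epi_factor; rewrite kp; have [_ []] := Smax _ (svalP i).
  pose eta i := projT1 (cid (ex i)).
  have pip i : pi =1 eta i \o p i := projT2 (cid (ex i)).
  exists I, (fun i => quotient_group (nI i)), eta; split=> [i|].
    by apply/(indecomposable_factor (pip i)); rewrite kp; exact: Smax (svalP i).
  apply: (isomorphic_fiber_product pip) => [h Kh ph|x Kx].
    suff : fundament_kernel pi h by rewrite fund.
    apply: (max_independent_bigcap (kernel_normal pi) indS maxS); split=> // N SN.
    by have := ph (exist _ N SN); rewrite kp.
  (* Independence speaks of families on all sets: extend x by 1 outside S. *)
  pose x' N := if pselect (S N) is left SN then x (exist _ N SN) else 1.
  have x'E (i : I) : x' (sval i) = x i.
    rewrite /x'; case: pselect => [SN|/(_ (svalP i))//].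
    by case: i SN => N SN SN' /=; rewrite (Prop_irrelevance SN' SN).
  have [N SN|k Kk kP] := Sx x'; first by rewrite (x'E (exist _ N SN)).
  exists k => // i; apply/esym/epi_eqP; rewrite kp -x'E.
  exact: kP (svalP i).
apply/seteqP; split=> [h [Kh hmax]|h ->].
  apply: pinj => // i; apply: hmax; exact/(indecomposable_factor (pip i)).
split; first exact: epi1.
by move=> N [[]].
Qed.
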